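(* $\mathrm{DIM}^1=\{A\in\mathbf C:\dim(A)=1\}$ is Wadge complete for $\boldsymbol\Pi^0_3$. Therefore $\mathrm{DIM}^1$ is not a $\boldsymbol\Sigma^0_3$-class, and in particular it is not a $\Sigma^0_3$-class.
   Context: $\mathbf{C}=\{0,1\}^{\mathbb N}$; $A\upharpoonright n$ is the first $n$ bits of $A$. $\dim(A)$ is the constructive dimension: the infimum of $s$ such that some lower semicomputable $s$-gale $d$ (i.e. $d:\{0,1\}^*\to[0,\infty)$ with $2^sd(w)=d(w0)+d(w1)$) satisfies $\limsup_n d(A\upharpoonright n)=\infty$; equivalently $\dim(A)=\liminf_n K(A\upharpoonright n)/n$, $K$ prefix-free Kolmogorov complexity. A Wadge reduction of $\mathcal A$ to $\mathcal B$ is a continuous $f:\mathbf C\to\mathbf C$ with $X\in\mathcal A\iff f(X)\in\mathcal B$; $\mathcal B$ is Wadge complete for a class $\boldsymbol\Gamma$ if $\mathcal B\in\boldsymbol\Gamma$ and every $\mathcal A\in\boldsymbol\Gamma$ Wadge reduces to $\mathcal B$. $\boldsymbol\Sigma^0_n,\boldsymbol\Pi^0_n$ denote Borel hierarchy levels, $\Sigma^0_n$ the lightface arithmetical level. *)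

(* Defs.v *)
From HB Require Import structures.
From mathcomp Require Import all_boot all_order all_algebra.
From mathcomp Require Import all_classical all_reals all_analysis.

Set Implicit Arguments.
Unset Strict Implicit.
Unset Printing Implicit Defensive.

Import Order.TTheory GRing.Theory Num.Theory.
Import numFieldNormedType.Exports.

Local Open Scope classical_set_scope.
Local Open Scope ring_scope.

(** Partial recursive functions (Kleene's mu-recursive functions).  A program
    carries no arity: it is run on a list of arguments, and a projection beyond
    the end of the list returns 0. *)

Inductive program : Type :=
  | Zero
  | Succ
  | Proj of nat
  | Comp (m : nat) of program & ('I_m -> program)
  | PrimRec of program & program
  | Mu of program.

(* [run p v y]: the program [p] halts on the arguments [v] with output [y].
   [PrimRec f g] is h(0, v) = f(v), h(n + 1, v) = g(n, h(n, v), v), and [Mu f]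
   on [v] is the least y such that f(y, v) = 0, all of f(0, v), ..., f(y, v)
   being defined. *)
Fixpoint run (p : program) (v : seq nat) (y : nat) : Prop :=
  match p with
  | Zero => y = 0%N
  | Succ => y = (nth 0%N v 0).+1
  | Proj i => y = nth 0%N v i
  | Comp m f g =>
      exists ws : m.-tuple nat,
        (forall i : 'I_m, run (g i) v (tnth ws i)) /\ run f ws y
  | PrimRec f g =>
      (fix primrec (n : nat) (z : nat) : Prop :=
         if n is n'.+1 then
           exists t : nat, primrec n' t /\ run g [:: n', t & behead v] z
         else run f (behead v) z) (head 0%N v) y
  | Mu f =>
      run f (y :: v) 0 /\
      (forall z : nat, (z < y)%N -> exists k : nat, run f (z :: v) k.+1)
  end.

(* The number whose binary expansion is 1w, most significant bit first; this is
   a bijection from binary strings onto the positive integers. *)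
Definition code_string (w : seq bool) : nat :=
  foldl (fun (n : nat) (b : bool) => (n.*2 + b)%N) 1%N w.

Definition initial_segment (A : cantor_space) (n : nat) : seq bool := mkseq A n.

(** Constructive dimension. *)

Definition is_gale (R : realType) (s : R) (d : seq bool -> R) : Prop :=
  (forall w, 0 <= d w) /\
  (forall w, 2 `^ s * d w = d (rcons w false) + d (rcons w true)).

(* The lower graph {(w, q) | q rational, q < d(w)} is computably enumerable,
   i.e. the domain of a partial recursive function.  A rational q is presented
   by naturals a, b, c with q = (a - b) / (c + 1). *)
Definition lower_semicomputable (R : realType) (d : seq bool -> R) : Prop :=
  exists p : program, forall (w : seq bool) (a b c : nat),
    (a%:R - b%:R) / c.+1%:R < d w <->
    exists y, run p [:: code_string w; a; b; c] y.

Definition succeeds_on (R : realType) (d : seq bool -> R) (A : cantor_space) :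
    Prop :=
  limn_esup (fun n => (d (initial_segment A n))%:E) = +oo%E.

Definition cdim (R : realType) (A : cantor_space) : \bar R :=
  ereal_inf [set s%:E | s in [set s : R | 0 <= s /\
    exists d : seq bool -> R,
      [/\ is_gale s d, lower_semicomputable d & succeeds_on d A]]].

Definition DIM1 (R : realType) : set cantor_space :=
  [set A | cdim R A = 1%E].

(** Borel hierarchy and Wadge reductions. *)

(* Finite levels, for n >= 1 (level 0 is a dummy copy of level 1).  Taking
   countable unions of complements of level n - 1 only, rather than of all lower
   levels, is the usual definition on a metrizable space, where the levels
   increase. *)
Fixpoint boldSigma (T : topologicalType) (n : nat) : set (set T) :=
  match n with
  | 0 | 1 => open
  | (_.+1 as m).+1 =>
      [set A | exists F : nat -> set T,
         (forall k, boldSigma m (~` F k)) /\ A = \bigcup_k F k]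
  end.

Definition boldPi (T : topologicalType) (n : nat) : set (set T) :=
  [set A | boldSigma n (~` A)].

Definition wadge_reduces (A B : set cantor_space) : Prop :=
  exists f : cantor_space -> cantor_space,
    continuous f /\ forall X, A X <-> B (f X).

Definition wadge_complete (Gamma : set (set cantor_space))
    (B : set cantor_space) : Prop :=
  Gamma B /\ forall A, Gamma A -> wadge_reduces A B.

(** Lightface (arithmetical) classes. *)

(* A is Sigma^0_3 if A = {X | exists a, forall b, exists c, Q(X|c, a, b)} for
   some decidable relation Q. *)
Definition lightSigma3 (A : set cantor_space) : Prop :=
  exists Q : seq bool -> nat -> nat -> bool,
    (exists p : program, forall w a b, run p [:: code_string w; a; b] (Q w a b))
    /\ forall X, A X <-> exists a, forall b, exists c, Q (initial_segment X c) a b.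

(* Main.v *)
(** Only countably many lower semicomputable gales exist, and success of one of
    them is a Pi^0_2 event; as the dimension never exceeds 1, the sequences of
    dimension < 1 form a Sigma^0_3 class.

    For hardness, a set Y of forced positions is turned into a sequence B that
    has a 0 at every forced position.  At a free position the bit is chosen so as
    not to increase a potential, the sum of 2^(-f) M and S^2, up to an additive
    constant: here M is a mixture of the martingales of all lower semicomputable
    s-gales with s < 1, f counts the forced positions so far, and S is the surplus
    of ones over zeros at free positions.  Hence M = O(n 2^f) and S = O(sqrt n).
    If Y has density 0, then f = o(n), so no such gale succeeds on B and
    dim B = 1.  If Y has positive upper density, then B has too many zeros, and a
    Bernoulli gale with rational parameters shows dim B < 1.  So it is enough
    that every Pi^0_3 class reduces to the class of sets Y of density 0.

    A Pi^0_3 class that is not Sigma^0_3 comes from diagonalizing against a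
    universal Sigma^0_3 relation. *)

Require Import Defs.
From HB Require Import structures.
From mathcomp Require Import all_boot all_order all_algebra.
From mathcomp Require Import all_classical all_reals all_analysis.
From mathcomp Require Import zify ring lra.

Set Implicit Arguments.
Unset Strict Implicit.
Unset Printing Implicit Defensive.

Import Order.TTheory GRing.Theory Num.Theory.
Import numFieldNormedType.Exports.

Local Open Scope classical_set_scope.
Local Open Scope ring_scope.

(** * Partial recursive functions and weights of binary strings *)

Section Computable.
Local Open Scope nat_scope.

(** The equivalence asserts totality and uniqueness of the output at once, on argument lists of
    every length. *)
Definition computes (p : program) (F : seq nat -> nat) :=
  forall v y, run p v y <-> y = F v.

Definition computable (F : seq nat -> nat) := exists p, computes p F.

Definition computable2 (op : nat -> nat -> nat) :=
  computable (fun v => op (nth 0 v 0) (nth 0 v 1)).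

Lemma eq_computable F G : F =1 G -> computable F -> computable G.
Proof. by move=> /funext ->. Qed.

Lemma computable_nth i : computable (fun v => nth 0 v i).
Proof. by exists (Proj i). Qed.

Lemma computable_comp m F (G : 'I_m -> seq nat -> nat) :
  computable F -> (forall i, computable (G i)) ->
  computable (fun v => F [tuple G i v | i < m]).
Proof.
move=> [f fF] /choice[g gG]; exists (Comp f g) => v y /=; split.
  move=> [ws [gws /fF ->]]; suff -> : ws = [tuple G i v | i < m] by [].
  by apply/eq_from_tnth => i; rewrite tnth_mktuple; exact/gG.
move=> ->; exists [tuple G i v | i < m]; split; last exact/fF.
by move=> i; rewrite tnth_mktuple; apply/gG.
Qed.

Lemma computable_comp1 F G : computable F -> computable G ->
  computable (fun v => F [:: G v]).
Proof.
move=> cF cG; have := @computable_comp 1 F (fun=> G) cF (fun=> cG).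
by apply: eq_computable => v; congr F; rewrite /= enum_ordSl enum_ord0.
Qed.

Lemma computable_app2 op G H :
  computable2 op -> computable G -> computable H ->
  computable (fun v => op (G v) (H v)).
Proof.
move=> cop cG cH.
have cGH (i : 'I_2) : computable (if i == ord0 then G else H) by case: ifP.
apply: eq_computable (computable_comp cop cGH) => v.
by rewrite /= enum_ordSl enum_ordSl enum_ord0.
Qed.

Lemma computable_rec F G : computable F -> computable G ->
  computable (fun v => nat_rect (fun=> nat) (F (behead v))
    (fun n t => G [:: n, t & behead v]) (head 0 v)).
Proof.
move=> [f fF] [g gG]; exists (PrimRec f g) => v y /=.
elim: (head 0 v) y => [|n IHn] y /=; first exact: fF.
split; first by move=> [t [/IHn -> /gG]].
by move=> ->; eexists; split; [exact/IHn|exact/gG].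
Qed.

Lemma computableS G : computable G -> computable (fun v => (G v).+1).
Proof.
by apply: (@computable_comp1 (fun v => (nth 0 v 0).+1)); exists Succ.
Qed.

Lemma computable_cst k : computable (fun=> k).
Proof. by elim: k => [|k]; [exists Zero|exact: computableS]. Qed.

Lemma computable_rec2 op (F G : seq nat -> nat) :
  computable F -> computable G ->
  (forall m, op 0 m = F [:: m]) ->
  (forall n m, op n.+1 m = G [:: n; op n m; m]) ->
  computable2 op.
Proof.
move=> cF cG op0 opS.
(* [PrimRec] hands the whole tail of its list to the subprograms; composing with two projections
   first cuts the list to two entries, so that the tail is [[:: m]]. *)
have cid (i : 'I_2) : computable (fun v => nth 0 v i) by exact: computable_nth.
apply: eq_computable (computable_comp (computable_rec cF cG) cid) => v.
rewrite /= enum_ordSl enum_ordSl enum_ord0 /=.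
by elim: (nth 0 v 0) => [|n /= ->]; rewrite ?op0 ?opS.
Qed.

Lemma computable_rec1 h (G : seq nat -> nat) :
  computable G -> (forall n, h n.+1 = G [:: n; h n]) ->
  forall H, computable H -> computable (fun v => h (H v)).
Proof.
move=> cG hS H cH.
have := computable_comp1 (computable_rec (computable_cst (h 0)) cG) cH.
apply: eq_computable => v /=; elim: (H v) => //= n ->.
by rewrite hS.
Qed.

Lemma computable_pred G : computable G -> computable (fun v => (G v).-1).
Proof. by apply: computable_rec1; first exact: (computable_nth 0). Qed.

Lemma computable_add G H : computable G -> computable H ->
  computable (fun v => G v + H v).
Proof.
apply: computable_app2.
exact: (computable_rec2 (computable_nth 0) (computableS (computable_nth 1))).
Qed.

Lemma computable_sub G H : computable G -> computable H ->
  computable (fun v => G v - H v).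
Proof.
(* The recursion runs on the first argument, which has to be the subtrahend; hence the swap. *)
move=> cG cH; apply: (@computable_app2 (fun x y => y - x) H G) => //.
apply: (computable_rec2 (computable_nth 0) (computable_pred (computable_nth 1))).
  exact: subn0.
by move=> n m; rewrite subnS.
Qed.

Lemma computable_mul G H : computable G -> computable H ->
  computable (fun v => G v * H v).
Proof.
apply: computable_app2; apply: (computable_rec2 (computable_cst 0)
  (computable_add (computable_nth 2) (computable_nth 1))) => //.
Qed.

Lemma computable_half G : computable G -> computable (fun v => (G v)./2).
Proof.
(* The recursion used is floor((n + 1)/2) = n - floor(n/2). *)
apply: (computable_rec1 (computable_sub (computable_nth 0) (computable_nth 1))).
by move=> n /=; lia.
Qed.

Lemma computable_odd G : computable G -> computable (fun v => odd (G v)).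
Proof.
apply: (@computable_rec1 (fun n => odd n) _
  (computable_sub (computable_cst 1) (computable_nth 1))).
by move=> n /=; case: odd.
Qed.

Lemma computable_leq G H : computable G -> computable H ->
  computable (fun v => G v <= H v).
Proof.
move=> cG cH.
apply: eq_computable (computable_sub (computable_cst 1) (computable_sub cG cH)).
by move=> v /=; lia.
Qed.

Lemma computable_if (b : seq nat -> bool) G H :
  computable (fun v => b v) -> computable G -> computable H ->
  computable (fun v => if b v then G v else H v).
Proof.
move=> cb cG cH.
apply: eq_computable (computable_add (computable_mul cb cG)
  (computable_mul (computable_sub (computable_cst 1) cb) cH)).
by move=> v /=; case: (b v); rewrite ?mul0n ?mul1n ?addn0.
Qed.

Lemma computable_iter_half G H : computable G -> computable H ->
  computable (fun v => iter (G v) half (H v)).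
Proof.
apply: (@computable_app2 (fun n x => iter n half x)).
exact: (computable_rec2 (computable_nth 0)
  (computable_half (computable_nth 1))).
Qed.

(* The factor of the product below contributed by the binary digit of x at the
   units place, with no contribution from the leading digit 1 of a code. *)
Definition digit_weight (A B x : nat) : nat :=
  if x <= 1 then 1 else if odd x then B else A.

(** Halving a code removes the last bit of its string, so the factors run through the bits. The
    bound x exceeds the length of the string; the extra factors are 1. *)
Definition code_weight (A B x : nat) : nat :=
  \prod_(i < x) digit_weight A B (iter i half x).

Lemma computable_code_weight A B G : computable G ->
  computable (fun v => code_weight A B (G v)).
Proof.
move=> cG.
have cW H : computable H -> computable (fun v => digit_weight A B (H v)).
  move=> cH; apply: computable_if; last apply: computable_if.
  - exact: computable_leq cH (computable_cst 1).
  - exact: computable_cst.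
  - exact: computable_odd.
  - exact: computable_cst.
  - exact: computable_cst.
apply: (@computable_app2
  (fun n x => \prod_(i < n) digit_weight A B (iter i half x))) => //.
apply: (computable_rec2 (computable_cst 1) (computable_mul (computable_nth 1)
  (cW _ (computable_iter_half (computable_nth 0) (computable_nth 2)))))
  => [m|n m].
  by rewrite big_ord0.
by rewrite big_ord_recr.
Qed.

Lemma code_string_rcons w b : code_string (rcons w b) = (code_string w).*2 + b.
Proof. by rewrite /code_string foldl_rcons. Qed.

Lemma size_lt_code_string w : size w < code_string w.
Proof.
elim/last_ind: w => // w b IHw; rewrite code_string_rcons size_rcons.
by move: IHw; case: b => /=; lia.
Qed.

Lemma code_weight_string A B w :
  code_weight A B (code_string w) =
  A ^ count_mem false w * B ^ count_mem true w.
Proof.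
(* The range of the product is detached from the code, which changes when a bit is removed. *)
suff H n : size w <= n ->
    \prod_(i < n) digit_weight A B (iter i half (code_string w)) =
    A ^ count_mem false w * B ^ count_mem true w.
  by apply: H; exact: ltnW (size_lt_code_string w).
elim/last_ind: w n => [|w b IHw] n.
  move=> _; rewrite big1 // => i _; rewrite /digit_weight.
  suff -> : iter i half (code_string [::]) <= 1 by [].
  by elim: (i : nat) => // k; rewrite iterS; lia.
rewrite size_rcons; case: n => // n wn; rewrite big_ord_recl code_string_rcons.
under eq_bigr => i _.
  rewrite lift0 iterSr addnC half_bit_double.
  over.
rewrite IHw // -cats1 !count_cat /= !addn0 {1}/digit_weight.
have -> : ((code_string w).*2 + b <= 1) = false.
  by have := size_lt_code_string w; lia.
case: b; rewrite oddD odd_double /= ?addn0 ?addn1 expnS; first exact: mulnCA.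
exact: mulnA.
Qed.

(** The search [Mu] is applied to 1 - b, which ignores the search variable: it stops at 0 or never.
    The search variable occupies position 0, so the arguments of b start at position 1. *)
Lemma semidecidable_of_computable (b : nat -> nat -> nat -> nat -> bool) :
  computable (fun v => b (nth 0 v 1) (nth 0 v 2) (nth 0 v 3) (nth 0 v 4)) ->
  exists p, forall i j k l,
    b i j k l <-> exists y, run p [:: i; j; k; l] y.
Proof.
move=> cb; have [f fP] := computable_sub (computable_cst 1) cb.
exists (Mu f) => i j k l; split=> [bT|[y [/fP /=]]].
  by exists 0; split=> //=; apply/fP => /=; rewrite bT.
by case: (b i j k l).
Qed.

End Computable.

(** * Topology and Borel classes of Cantor space *)

Lemma eq_initial_segment (X X' : cantor_space) n :
  initial_segment X n = initial_segment X' n <->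
  forall i, (i < n)%N -> X i = X' i.
Proof.
split=> [e i ilt|e].
  by move: (congr1 (fun s => nth false s i) e); rewrite !nth_mkseq.
apply: (@eq_from_nth _ false); rewrite !size_mkseq // => i ilt.
by rewrite !nth_mkseq // e.
Qed.

Lemma initial_segment_leq (X X' : cantor_space) m n : (m <= n)%N ->
  initial_segment X n = initial_segment X' n ->
  initial_segment X m = initial_segment X' m.
Proof.
move=> mn /eq_initial_segment e; apply/eq_initial_segment => i im.
by apply: e; exact: leq_trans mn.
Qed.

Definition cylinder (X : cantor_space) n : set cantor_space :=
  [set X' | initial_segment X' n = initial_segment X n].

Lemma cylinder_filter X : Filter (filter_from setT (cylinder X)).
Proof.
apply: filter_fromT_filter; first by exists 0%N.
move=> i j; exists (maxn i j) => X' X'X; split;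
  by apply: initial_segment_leq X'X; rewrite (leq_maxl, leq_maxr).
Qed.

Lemma cvg_cantor (F : set_system cantor_space) (X : cantor_space) :
  Filter F -> (forall i, F [set X' | X' i = X i]) -> F --> X.
Proof.
move=> FF FX; apply/cvg_sup => i U.
have /= -> := @nbhsE (initial_topology (fun f : cantor_space => f i)) X.
case=> B [[C oC <-] CX] /filterS; apply.
by apply: filterS (FX i) => X' /= ->.
Qed.

(** The filter generated by the cylinders converges coordinatewise to X, hence in the product
    topology; conversely a cylinder is a finite intersection of conditions on single coordinates. *)
Lemma nbhs_cantorP X (A : set cantor_space) :
  nbhs X A <-> exists n, cylinder X n `<=` A.
Proof.
split=> [nA|[n nA]].
  have FX : filter_from setT (cylinder X) --> X.
    apply: cvg_cantor; first exact: cylinder_filter.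
    by move=> i; exists i.+1 => // X' /eq_initial_segment /(_ i (ltnSn i)).
  by have [n _ ?] := FX A nA; exists n.
apply: filterS nA _.
elim: n => [|n IHn].
  by apply: filterS filterT => X' _; apply/eq_initial_segment.
have ni : nbhs X [set X' : cantor_space | X' n = X n].
  have c := @proj_continuous nat (fun=> bool) n X.
  apply: (c [set b | b = X n]).
  exact: discrete_set1.
apply: filterS2 IHn ni => X' /eq_initial_segment e en.
apply/eq_initial_segment => i; rewrite ltnS leq_eqVlt => /predU1P[->//|].
exact: e.
Qed.

Lemma open_cantorP (A : set cantor_space) :
  open A <-> forall X, A X -> exists n, cylinder X n `<=` A.
Proof.
rewrite openE; split=> oA X AX; first exact/nbhs_cantorP/oA.
exact/nbhs_cantorP/oA.
Qed.

Lemma continuous_cantor (f : cantor_space -> cantor_space) :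
  (forall X i, exists n, forall X', cylinder X n X' -> f X' i = f X i) ->
  continuous f.
Proof.
move=> fn X; apply: cvg_cantor => i /=.
by apply/nbhs_cantorP; have [n] := fn X i; exists n.
Qed.

Lemma cantor_continuous (f : cantor_space -> cantor_space) X i :
  continuous f -> exists n, forall X', cylinder X n X' -> f X' i = f X i.
Proof.
move=> cf; have /nbhs_cantorP : nbhs X (f @^-1` cylinder (f X) i.+1).
  by apply: cf; apply/nbhs_cantorP; exists i.+1.
by move=> [n fn]; exists n => X' /fn /eq_initial_segment /(_ i (ltnSn i)).
Qed.

Lemma boldSigma_preimage (S T : topologicalType) (f : S -> T) n A :
  continuous f -> boldSigma n A -> boldSigma n (f @^-1` A).
Proof.
move=> cf; elim: n A => [|[|n] IHn] A.
- by apply: open_comp => x _; exact: cf.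
- by apply: open_comp => x _; exact: cf.
move=> [F [sF ->]]; exists (fun k => f @^-1` F k); split.
  by move=> k; rewrite preimage_setC; exact: IHn (sF k).
exact: preimage_bigcup.
Qed.

(* For each n >= 1, the relation [universal n Y X] is boldface Sigma^0_n and its
   sections at the codes Y are all the Sigma^0_n subsets of Cantor space. *)
Fixpoint universal (n : nat) (Y X : cantor_space) : Prop :=
  match n with
  | 0 | 1 => exists w : seq bool,
      Y (@pickle (seq bool) w) /\ initial_segment X (size w) = w
  | (_.+1 as m).+1 => exists k,
      ~ universal m (fun i => Y (@pickle (nat * nat)%type (k, i))) X
  end.

(** An open set is coded by the words whose cylinders it contains; a union is coded by packing the
    codes of the complements of its terms into one sequence. *)
Lemma universal_surj n A : @boldSigma cantor_space n A ->
  exists Y, forall X, A X <-> universal n Y X.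
Proof.
have openU B : open B -> exists Y, forall X, B X <-> universal 1 Y X.
  move=> /open_cantorP oB.
  pose sub w := [set X | initial_segment X (size w) = w] `<=` B.
  exists (fun i =>
    if @unpickle (seq bool) i is Some w then `[< sub w >] else false).
  move=> X; split=> [/oB[m Bm]|[w []]].
    exists (initial_segment X m); rewrite pickleK size_mkseq; split=> //.
    by apply/asboolP; rewrite /sub size_mkseq.
  by rewrite pickleK => /asboolP; apply.
elim: n A => [|[|n] IHn] A; [exact: openU|exact: openU|].
move=> [F [sF ->]]; have /choice[Y UY] k := IHn _ (sF k).
pose Z i := if @unpickle (nat * nat)%type i is Some p then Y p.1 p.2 else false.
have E k X : universal n.+1 (fun i : nat => Z (pickle (k, i))) X <->
    (~` F k) X.
  rewrite UY; have -> // : (fun i : nat => Z (pickle (k, i))) = Y k.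
  by apply/funext => j; rewrite /Z pickleK.
exists Z => X; split=> [[k _ FX]|[k nU]]; first by exists k => /E.
by exists k => //; apply: contrapT => nFX; apply: nU; exact/E.
Qed.

(** The code may depend continuously on X, so that the induction can pass to the k-th section of the
    code. The diagonal set is the case of the identity. *)
Lemma universal_Sigma n (f : cantor_space -> cantor_space) :
  continuous f -> boldSigma n [set X | universal n (f X) X].
Proof.
have openU (g : cantor_space -> cantor_space) : continuous g ->
    open [set X | universal 1 (g X) X].
  move=> cg; apply/open_cantorP => X [w [gXw Xw]].
  have [m gm] := cantor_continuous X (@pickle (seq bool) w) cg.
  exists (maxn m (size w)) => X' X'X; exists w; split.
    by rewrite gm //; apply: initial_segment_leq X'X; exact: leq_maxl.
  by rewrite -{2}Xw; apply: initial_segment_leq X'X; exact: leq_maxr.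
elim: n f => [|[|n] IHn] f; [exact: openU|exact: openU|].
move=> cf.
pose G k := [set X |
  universal n.+1 (fun i => f X (@pickle (nat * nat)%type (k, i))) X].
exists (fun k => ~` G k); split; last first.
  by apply/seteqP; split=> X [k]; [exists k|move=> _; exists k].
move=> k; rewrite setCK; apply: IHn; apply: continuous_cantor => X i.
exact: cantor_continuous.
Qed.

Lemma boldPi_not_boldSigma n :
  exists A, @boldPi cantor_space n A /\ ~ @boldSigma cantor_space n A.
Proof.
exists (~` [set X | universal n X X]); split.
  by rewrite /boldPi /= setCK; apply: (@universal_Sigma n id) => X; exact: cvg_id.
move=> /universal_surj[Y /(_ Y)[nUU UU]].
have nU : ~ universal n Y Y by move=> U; exact: (UU U).
exact: nU (nUU nU).
Qed.

Lemma lightSigma3_boldSigma A : lightSigma3 A -> @boldSigma cantor_space 3 A.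
Proof.
move=> [Q [_ AQ]].
exists (fun a => [set X | forall b, exists c, Q (initial_segment X c) a b]).
split; last by apply/seteqP; split=> X; rewrite AQ => -[a]; exists a.
move=> a; exists (fun b => [set X | forall c, ~~ Q (initial_segment X c) a b]).
split; last first.
  apply/seteqP; split=> X /=.
    by move=> /existsNP[b /forallNP bP]; exists b => // c; exact/negP.
  by move=> [b _ bP] /(_ b)[c]; exact/negP.
move=> b; apply/open_cantorP => X /existsNP[c /negP/negPn Qc].
exists c => X' X'X /(_ c); by rewrite X'X Qc.
Qed.

(** * Lower semicomputable gales *)

Section Programs.

(** An encoding into a countable type of trees, showing that programs are countable; the family of
    subprograms of [Comp] becomes a list of children. *)
Fixpoint program_tree (p : program) : GenTree.tree nat :=
  match p with
  | Zero => GenTree.Node 0 [::]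
  | Succ => GenTree.Node 1 [::]
  | Proj i => GenTree.Leaf i
  | Comp m f g => GenTree.Node 2
      (program_tree f :: [seq program_tree (g i) | i <- ord_enum m])
  | PrimRec f g => GenTree.Node 3 [:: program_tree f; program_tree g]
  | Mu f => GenTree.Node 4 [:: program_tree f]
  end.

Lemma program_tree_inj : injective program_tree.
Proof.
elim=> [||i|m f IHf g IHg|f IHf g IHg|f IHf] [||i'|m' f' g'|f' g'|f'] //=.
- by case=> ->.
- case=> /IHf -> e; have mm' : m = m'.
    have sz k : size (ord_enum k) = k.
      by rewrite -(size_map val) val_ord_enum size_iota.
    by have := congr1 size e; rewrite !size_map !sz.
  case: m' / mm' g' e => g' /eq_in_map e; congr Comp.
  by apply/funext => i; apply: IHg; apply: e; rewrite mem_ord_enum.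
- by case=> /IHf -> /IHg ->.
- by case=> /IHf ->.
Qed.

End Programs.

Section RealLemmas.
Context (R : realType).
Implicit Types (x y : R) (d : seq bool -> R) (A : cantor_space).

(** A rational strictly between two distinct reals separates their cuts. A nonnegative numerator is
    presented as n - 0, a negative one as 0 - (n + 1). *)
Lemma eq_of_rational_cuts x y :
  (forall a b c : nat, (a%:R - b%:R) / c.+1%:R < x <->
    (a%:R - b%:R) / c.+1%:R < y) -> x = y.
Proof.
wlog xy : x y / x < y.
  move=> H e; have [/H|/H yx|//] := ltgtP x y; first exact.
  by apply/esym/yx => a b c; split=> /e.
move=> e; have [q] := rat_in_itvoo xy.
rewrite in_itv /= => /andP[]; case: (ratP q) => n k _.
rewrite fmorph_div /= ratr_nat ratr_int => xq qy.
suff : n%:~R / k.+1%:R < x by move=> /(lt_trans xq); rewrite ltxx.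
case: n xq qy => n _.
  by have := e n 0 k; rewrite subr0 => -[_ +] => h /h.
have := e 0 n.+1 k; rewrite sub0r NegzE mulrNz => -[_ +]; exact.
Qed.

(** A program enumerating the lower graph of d determines d, so functions can be indexed by program
    codes; an index that defines no function gets the default 0. *)
Lemma countable_lower_semicomputable : exists e : nat -> seq bool -> R,
  forall d, lower_semicomputable d -> exists i, e i = d.
Proof.
pose rel i d := exists p, pickle (program_tree p) = i /\
  forall (w : seq bool) (a b c : nat), (a%:R - b%:R) / c.+1%:R < d w <->
    exists y : nat, run p [:: code_string w; a; b; c] y.
exists (fun i => xget (fun=> 0) (rel i)) => d [p pd].
exists (pickle (program_tree p)).
have [|p' [/(pcan_inj (@pickleK _))/program_tree_inj -> p'd]] :=
  @xgetPex _ (fun=> 0) (rel (pickle (program_tree p))); first by exists d, p.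
by apply/funext => w; apply: eq_of_rational_cuts => a b c; rewrite pd p'd.
Qed.

Lemma succeeds_onP d A : succeeds_on d A <->
  forall (M : R) (N : nat), exists2 n, (N <= n)%N & M < d (initial_segment A n).
Proof.
rewrite /succeeds_on /limn_esup /limf_esup; split.
  move=> /ereal_inf_pinfty dA M N; apply: contrapT => nd.
  have : ereal_sup ((fun n => (d (initial_segment A n))%:E) @` [set n | (N <= n)%N])
      = +oo%E.
    by apply: dA; exists [set n | (N <= n)%N] => //; exists N.
  apply/eqP; rewrite lt_eqF // (@le_lt_trans _ _ M%:E) ?ltry //.
  apply: ge_ereal_sup => _ [n Nn <-]; rewrite lee_fin leNgt.
  by apply/negP => Md; apply: nd; exists n.
move=> dA; apply/ereal_inf_pinfty => _ [V [N _ NV] <-].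
apply: eq_infty => M; have [n Nn Md] := dA M N.
apply: le_ereal_sup_tmp; exists (d (initial_segment A n))%:E.
  by exists n => //; apply: NV.
by rewrite lee_fin ltW.
Qed.

Lemma expr_ge_bernoulli x n : 0 <= x -> 1 + n%:R * (x - 1) <= x ^+ n.
Proof.
move=> x0; elim: n => [|n IHn]; first by rewrite expr0 mul0r addr0.
rewrite exprS; apply: le_trans (ler_wpM2l x0 IHn).
have : 0 <= n%:R * (x - 1) ^+ 2 by rewrite mulr_ge0 ?sqr_ge0.
by rewrite -natr1; lra.
Qed.

Lemma expr_unbounded x (M : R) : 1 < x ->
  exists N, forall n, (N <= n)%N -> M < x ^+ n.
Proof.
move=> x1; exists (Num.bound `|M / (x - 1)|) => n Nn.
have x10 : 0 < x - 1 by rewrite subr_gt0.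
have x0 : 0 <= x by lra.
apply: lt_le_trans (expr_ge_bernoulli n x0).
suff : M < n%:R * (x - 1) by lra.
rewrite -ltr_pdivrMr //; apply: le_lt_trans (ler_norm _) _.
by apply: lt_le_trans (archi_boundP (normr_ge0 _)) _; rewrite ler_nat.
Qed.

End RealLemmas.

(** * Gales in terms of their ratio, Bernoulli gales, and dimension one *)

Section Dimension.
Context (R : realType).
Implicit Types (r x y s : R) (d : seq bool -> R) (A : cantor_space).

(* An s-gale in terms of r = 2^s. *)
Definition ratio_gale r d :=
  (forall w, 0 <= d w) /\
  forall w, r * d w = d (rcons w false) + d (rcons w true).

Lemma ratio_of_exponent s : 0 <= s ->
  1 <= 2 `^ s /\ (s < 1 -> 2 `^ s < 2).
Proof.
move=> s0; split.
  by rewrite -[leLHS](powRr0 (2 : R)) (ler_powR _ s0) // ler1n.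
move=> s1; rewrite -[ltRHS](powRr1 (ler0n R 2)).
by rewrite /powR pnatr_eq0 /= ltr_expR ltr_pM2r // ln_gt0 // ltr1n.
Qed.

Lemma exponent_of_ratio r : 1 <= r ->
  exists s, [/\ 0 <= s, 2 `^ s = r & forall t, r < 2 `^ t -> s < t].
Proof.
move=> r1; have r0 : 0 < r by apply: lt_le_trans r1.
have l2 : 0 < ln (2 : R) by rewrite ln_gt0 // ltr1n.
exists (ln r / ln 2); split.
- by rewrite divr_ge0 ?ln_ge0 ?ler1n.
- by rewrite /powR pnatr_eq0 /= divfK ?gt_eqF // lnK ?posrE.
move=> t; rewrite {1}/powR pnatr_eq0 /= -[X in X < _](lnK (x := r)) //.
by rewrite ltr_expR ltr_pdivrMr.
Qed.

Definition bernoulli_gale (P0 P1 Q : nat) (w : seq bool) : R :=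
  (P0%:R / Q%:R) ^+ count_mem false w * (P1%:R / Q%:R) ^+ count_mem true w.

Lemma ratio_gale_bernoulli P0 P1 Q :
  ratio_gale ((P0%:R + P1%:R) / Q%:R) (bernoulli_gale P0 P1 Q).
Proof.
split=> w; first by rewrite mulr_ge0 // exprn_ge0 // divr_ge0.
rewrite /bernoulli_gale -!cats1 !count_cat /= !addn0 !addn1 !exprS.
ring.
Qed.

(** Clearing denominators turns the comparison with a rational into a decidable inequality between
    naturals. *)
Lemma bernoulli_lower_semicomputable P0 P1 Q : (0 < Q)%N ->
  lower_semicomputable (bernoulli_gale P0 P1 Q).
Proof.
move=> Q0.
have cn := computable_nth.
have [p pP] := semidecidable_of_computable (b := fun i a b c =>
    ((a * code_weight Q Q i).+1 <=
      b * code_weight Q Q i + c.+1 * code_weight P0 P1 i)%N)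
  (computable_leq
    (computableS (computable_mul (cn 2) (computable_code_weight Q Q (cn 1))))
    (computable_add
      (computable_mul (cn 3) (computable_code_weight Q Q (cn 1)))
      (computable_mul (computableS (cn 4)) (computable_code_weight P0 P1 (cn 1))))).
exists p => w a b c; rewrite -pP !code_weight_string.
set z := count_mem false w; set o := count_mem true w.
have QR : (0 : R) < Q%:R by rewrite ltr0n.
have -> : bernoulli_gale P0 P1 Q w = (P0 ^ z * P1 ^ o)%:R / (Q ^ z * Q ^ o)%:R.
  rewrite /bernoulli_gale -/z -/o !natrM !natrX !expr_div_n.
  by field; rewrite !expf_neq0 // gt_eqF.
set T := (P0 ^ z * P1 ^ o)%N; set W := (Q ^ z * Q ^ o)%N.
have W0 : (0 : R) < W%:R by rewrite ltr0n muln_gt0 !expn_gt0 Q0.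
rewrite ltr_pdivrMr ?ltr0n // mulrAC ltr_pdivlMr // mulrBl ltrBlDr.
by rewrite -!natrM -natrD ltr_nat addnC [(T * _)%N]mulnC.
Qed.

Lemma cdim_lt A d r t : 1 <= r -> r < 2 `^ t -> ratio_gale r d ->
  lower_semicomputable d -> succeeds_on d A -> (cdim R A < t%:E)%E.
Proof.
move=> r1 rt [d0 dr] lsc dA; have [s [s0 sr st]] := exponent_of_ratio r1.
apply: (@le_lt_trans _ _ s%:E); last by rewrite lte_fin st.
apply: ereal_inf_lbound; exists s => //; split=> //.
by exists d; split=> //; split=> // w; rewrite sr.
Qed.

(** The gale that multiplies its capital by 1 + 1/(2k) on either bit succeeds on every sequence and
    has ratio 2 + 1/k, which is below 2^(1 + e) for large k. *)
Lemma cdim_le1 A : (cdim R A <= 1)%E.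
Proof.
apply/lee_addgt0Pr => e e0; rewrite -EFinD.
have e2 : 2 < 2 `^ (1 + e) :> R.
  rewrite -[ltLHS](powRr1 (ler0n R 2)) /powR pnatr_eq0 /=.
  by rewrite ltr_expR ltr_pM2r ?ln_gt0 ?ltr1n // ltrDl.
pose k := Num.bound (2 `^ (1 + e) - 2)^-1.
have k0 : (0 < k)%N.
  by rewrite -(ltr0n R) (le_lt_trans _ (archi_boundP _)) // invr_ge0 subr_ge0 ltW.
have kR : (0 : R) < k%:R by rewrite ltr0n.
have ke : k%:R^-1 < 2 `^ (1 + e) - 2.
  rewrite -[ltRHS]invrK ltf_pV2 ?posrE ?invr_gt0 ?subr_gt0 //.
  by apply: archi_boundP; rewrite invr_ge0 subr_ge0 ltW.
have E : ((2 * k + 1)%:R + (2 * k + 1)%:R) / (2 * k)%:R = 2 + k%:R^-1 :> R.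
  by rewrite natrD natrM; field; rewrite gt_eqF.
apply/ltW/(@cdim_lt A
  (bernoulli_gale (2 * k + 1) (2 * k + 1) (2 * k)) (2 + k%:R^-1)).
- have := kR; rewrite -invr_gt0; lra.
- lra.
- by rewrite -E; exact: ratio_gale_bernoulli.
- by apply: bernoulli_lower_semicomputable; rewrite muln_gt0.
apply/succeeds_onP => M N.
have x1 : 1 < (2 * k + 1)%:R / (2 * k)%:R :> R.
  by rewrite ltr_pdivlMr ?ltr0n ?muln_gt0 // mul1r ltr_nat addn1.
have [N' N'P] := expr_unbounded M x1.
exists (maxn N N'); first exact: leq_maxl.
rewrite /bernoulli_gale -exprD.
have -> : (count_mem false (initial_segment A (maxn N N')) +
    count_mem true (initial_segment A (maxn N N')))%N = maxn N N'.
  rewrite -[RHS](size_mkseq A) -(count_predC (pred1 false)); congr addn.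
  by apply: eq_count => -[].
by apply: N'P; exact: leq_maxr.
Qed.

(** As the dimension is at most 1, it differs from 1 only through a successful gale of exponent
    below 1, that is, of ratio below 2. *)
Lemma DIM1P A : DIM1 R A <->
  forall d r, 1 <= r < 2 -> ratio_gale r d -> lower_semicomputable d ->
    ~ succeeds_on d A.
Proof.
split=> [dA d r /andP[r1 r2] dr lsc dS|noA].
  have : (cdim R A < 1)%E.
    by apply: cdim_lt dr lsc dS => //; rewrite powRr1.
  by rewrite dA ltxx.
apply/eqP; rewrite eq_le cdim_le1 /=; apply: le_ereal_inf_tmp.
move=> _ [s [s0 [d [[d0 ds] lsc dA]]] <-]; rewrite lee_fin leNgt.
apply/negP => s1; have [r1 /(_ s1) r2] := ratio_of_exponent s0.
by apply: (noA d (2 `^ s)) => //; rewrite r1.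
Qed.

(* With [t = 9 * m], the factors [1 + 1/t] and [1 - 1/t - 1/t^2] have sum less
   than 2, and a surplus of zeros of one in [m] bits outweighs the loss
   incurred on the balanced bits. *)
Lemma zero_surplus_not_DIM1 A m :
  (forall N, exists2 n, (N <= n)%N &
    (n + m * count_mem true (initial_segment A n) <=
      m * count_mem false (initial_segment A n))%N) ->
  ~ DIM1 R A.
Proof.
move=> surplus /DIM1P; pose t := (9 * m)%N.
have m0 : (0 < m)%N.
  by have [n] := surplus 1%N; case: (posnP m) => // ->; lia.
pose x : R := t%:R^-1.
have mR : (1 : R) <= m%:R by rewrite ler1n.
have tR : (0 : R) < t%:R by rewrite ltr0n muln_gt0.
have x0 : 0 < x by rewrite invr_gt0.
have x9 : m%:R * x = 9^-1.
  by rewrite /x natrM; field; rewrite gt_eqF // ltr0n.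
have xlt : x <= 9^-1 by nra.
pose a := 1 + x; pose b := 1 - x - x ^+ 2.
have aE : (t ^ 2 + t)%:R / (t ^ 2)%:R = a.
  by rewrite natrD natrX /a /x; field; rewrite gt_eqF.
have bE : (t ^ 2 - t - 1)%:R / (t ^ 2)%:R = b.
  rewrite !natrB ?natrX /b /x; first by field; rewrite gt_eqF.
    by rewrite -mulnn leq_pmulr // muln_gt0.
  by rewrite subn_gt0 -mulnn ltn_Pmulr //; lia.
move=> /(_ (bernoulli_gale (t ^ 2 + t) (t ^ 2 - t - 1) (t ^ 2)) (a + b)).
apply.
- by rewrite /a /b; nra.
- by rewrite -aE -bE -mulrDl; exact: ratio_gale_bernoulli.
- by apply: bernoulli_lower_semicomputable; rewrite expn_gt0; lia.
have ab : 1 - 3 * x ^+ 2 <= a * b by rewrite /a /b; nra.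
have ab0 : 0 <= a * b by nra.
have ab1 : a * b <= 1 by rewrite /a /b; nra.
have a1 : 1 <= a by rewrite /a; lra.
(* Bernoulli's inequality gives (ab)^m >= 1 - 3mx^2 = 1 - x/3, and (1 + x)(1 - x/3) > 1. *)
have g1 : 1 < a * (a * b) ^+ m.
  have := expr_ge_bernoulli m ab0.
  have : 1 - m%:R * (3 * x ^+ 2) <= 1 + m%:R * (a * b - 1) by nra.
  have -> : m%:R * (3 * x ^+ 2) = x / 3.
    by rewrite mulrCA expr2 (mulrA m%:R) x9; field.
  move=> h1 h2; have h3 := le_trans h1 h2.
  have : a * (1 - x / 3) <= a * (a * b) ^+ m by apply: ler_wpM2l => //; lra.
  by apply: lt_le_trans; rewrite /a; nra.
apply/succeeds_onP => M N.
(* The m-th power of the capital after n bits will be compared with the n-th power of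
   [a * (a * b) ^+ m]; hence the threshold |M|^m. *)
have [N' N'P] := expr_unbounded (`|M| ^+ m) g1.
have [n nN surp] := surplus (maxn N N').
move: nN; rewrite geq_max => /andP[nN nN'].
exists n => //; rewrite /bernoulli_gale aE bE.
move: surp; set z := count_mem false _; set o := count_mem true _ => surp.
rewrite ltNge; apply/negP => dM.
have oz : (o <= z)%N by move: surp m0; nia.
have on : (o <= n)%N by rewrite -[leqRHS](size_mkseq A) count_size.
have d0 : 0 <= a ^+ z * b ^+ o.
  by rewrite mulr_ge0 // exprn_ge0 // /a /b; nra.
have := N'P n nN'; apply/negP; rewrite -leNgt.
apply: (@le_trans _ _ ((a ^+ z * b ^+ o) ^+ m)); last first.
  apply: lerXn2r; rewrite ?nnegrE ?normr_ge0 //.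
  exact: le_trans dM (ler_norm _).
(* Each one is paired with a zero. The unpaired zeros satisfy m(z - o) >= n with a >= 1, and the
   pairs satisfy o <= n with ab <= 1. *)
have -> : (a ^+ z * b ^+ o) ^+ m = a ^+ (m * (z - o)) * (a * b) ^+ (m * o).
  rewrite !(mulnC m) !exprM -exprMn; congr (_ ^+ m).
  by rewrite exprMn mulrA -exprD subnK.
rewrite exprMn -exprM; apply: ler_pM; rewrite ?exprn_ge0 //.
- by apply: le_trans a1.
- by apply: ler_weXn2l => //; rewrite mulnBr; lia.
by apply: ler_wiXn2l => //; rewrite leq_mul2l on orbT.
Qed.

End Dimension.

(** * The diagonal sequence with forced zeros *)

Definition forced_count (Y : cantor_space) n :=
  count_mem true (initial_segment Y n).

Lemma initial_segmentS (X : cantor_space) n :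
  initial_segment X n.+1 = rcons (initial_segment X n) (X n).
Proof. by rewrite /initial_segment mkseqS. Qed.

Lemma forced_countS Y n : forced_count Y n.+1 = (forced_count Y n + Y n)%N.
Proof.
by rewrite /forced_count initial_segmentS -cats1 count_cat /= addn0 eqb_id.
Qed.

Lemma forced_count_leq Y n : (forced_count Y n <= n)%N.
Proof. by rewrite -[leqRHS](size_mkseq Y) count_size. Qed.

(** Density 0, tested against the densities 2^-K; the constant C takes the place of a bound valid
    from some point on. *)
Definition sparse Y := forall K, exists C, forall n,
  (forced_count Y n * 2 ^ K <= n + C)%N.

(** Positive upper density. *)
Definition recurrently_dense Y := exists K, forall N, exists2 n,
  (N <= n)%N & (n <= forced_count Y n * 2 ^ K)%N.

Section Potential.
Context (R : realType).
Implicit Types (d : seq bool -> R) (D : nat -> seq bool -> R) (Y : cantor_space).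

Definition test_family D := forall i, ratio_gale 2 (D i) /\ D i [::] <= 1.

Lemma martingale_le d w : ratio_gale 2 d -> d w <= 2 ^+ size w * d [::].
Proof.
move=> [d0 dE]; elim/last_ind: w => [|w b IHw]; first by rewrite mul1r.
rewrite size_rcons exprS -mulrA.
apply: (@le_trans _ _ (2 * d w)); last by rewrite ler_pM2l.
have h0 := d0 (rcons w false); have h1 := d0 (rcons w true).
by rewrite dE; case: b; lra.
Qed.

(** Multiplying an r-gale by (2/r)^|w| makes it a martingale, so s = r/2. Dividing by 1 plus the
    initial capital normalizes it even when that capital is 0. An index without a suitable gale gets
    the zero martingale. *)
Lemma exists_test_family : exists D, test_family D /\
  forall d r, 1 <= r < 2 -> ratio_gale r d -> lower_semicomputable d ->
    exists i c s, [/\ 0 <= c, 0 < s < 1 &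
      forall w, d w <= c * s ^+ size w * D i w].
Proof.
have [e eP] := countable_lower_semicomputable R.
have /choice[D DP] : forall i, exists E : seq bool -> R,
    [/\ ratio_gale 2 E, E [::] <= 1 &
    forall r, 1 <= r < 2 -> ratio_gale r (e i) ->
      exists c s, [/\ 0 <= c, 0 < s < 1 &
        forall w, e i w <= c * s ^+ size w * E w]].
  move=> i; have [[r [/andP[r1 r2] eg]]|no] :=
    pselect (exists r, 1 <= r < 2 /\ ratio_gale r (e i)); last first.
    exists (fun=> 0); split => //.
      by split=> // w; rewrite mulr0 addr0.
    by move=> r r12 eg; case: no; exists r.
  have [e0 eE] := eg; have en := e0 [::]; have r0 : 0 < r by lra.
  exists (fun w => (2 / r) ^+ size w * (e i w / (1 + e i [::]))); split.
  - split=> w.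
      by rewrite mulr_ge0 // ?exprn_ge0 ?divr_ge0 // ?e0; lra.
    rewrite !size_rcons -mulrDr -mulrDl -eE exprS.
    by field; apply/andP; split; rewrite gt_eqF //; lra.
  - by rewrite mul1r ler_pdivrMr; lra.
  - move=> _ _ _; exists (1 + e i [::]), (r / 2); split; [lra|lra|move=> w].
    rewrite mulrA -(mulrA (1 + _)) -exprMn.
    rewrite (_ : r / 2 * (2 / r) = 1) ?expr1n ?mulr1; last first.
      by field; rewrite gt_eqF.
    by rewrite mulrC divfK // gt_eqF //; lra.
exists D; split=> [i|d r r12 dg /eP[i ei]]; first by have [] := DP i.
have [_ _ /(_ r r12)] := DP i; rewrite ei => /(_ dg)[c [s H]].
by exists i, c, s.
Qed.

(** The martingale of index i enters only at lengths above i. This keeps the sum finite, and the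
    entry at each length costs a bounded amount because D i grows at most like 2^|w|. *)
Definition mixture D (w : seq bool) : R :=
  \sum_(i < size w) 2 ^- i * D i w.

(** Forced positions carry zeros in the constructed sequence; adding their number leaves ones minus
    zeros at the free positions. *)
Definition surplus Y w : R :=
  (count_mem true w)%:R - (count_mem false w)%:R + (forced_count Y (size w))%:R.

Definition potential D Y w : R :=
  2 ^- forced_count Y (size w) * mixture D w + surplus Y w ^+ 2.

Definition next_bit D Y w : bool := ~~ Y (size w) &&
  (potential D Y (rcons w true) <= potential D Y (rcons w false)).

Fixpoint diagonal_word D Y n : seq bool :=
  if n is n'.+1 then
    rcons (diagonal_word D Y n') (next_bit D Y (diagonal_word D Y n'))
  else [::].

Definition diagonal D Y : cantor_space :=
  fun n => next_bit D Y (diagonal_word D Y n).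

Lemma size_diagonal_word D Y n : size (diagonal_word D Y n) = n.
Proof. by elim: n => //= n IHn; rewrite size_rcons IHn. Qed.

Lemma initial_segment_diagonal D Y n :
  initial_segment (diagonal D Y) n = diagonal_word D Y n.
Proof. by elim: n => // n IHn; rewrite initial_segmentS IHn. Qed.

Lemma diagonal_continuous D : continuous (diagonal D).
Proof.
have potE Y Y' w : initial_segment Y (size w) = initial_segment Y' (size w) ->
    potential D Y w = potential D Y' w.
  by move=> e; rewrite /potential /surplus /forced_count e.
have wordE Y Y' n : initial_segment Y n = initial_segment Y' n ->
    diagonal_word D Y n = diagonal_word D Y' n.
  elim: n => //= n IHn e.
  have -> := IHn (initial_segment_leq (leqnSn n) e).
  rewrite /next_bit !(potE Y Y') ?size_rcons ?size_diagonal_word //.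
  by move/eq_initial_segment: e => ->.
apply: continuous_cantor => Y n; exists n.+1 => Y' Y'Y.
by have := wordE _ _ _ Y'Y; rewrite /= => /rcons_inj[].
Qed.

Section Bounds.
Variable D : nat -> seq bool -> R.
Hypothesis tD : test_family D.

Lemma mixture_ge0 w : 0 <= mixture D w.
Proof.
apply: sumr_ge0 => i _; have [[D0 _] _] := tD i.
by rewrite mulr_ge0 // invr_ge0 exprn_ge0.
Qed.

Lemma mixture_rcons w :
  mixture D (rcons w false) + mixture D (rcons w true) <= 2 * mixture D w + 2.
Proof.
rewrite /mixture !size_rcons !big_ord_recr /= addrACA -big_split /= mulr_sumr.
apply: lerD.
  apply: ler_sum => i _; have [[_ DE] _] := tD i.
  by rewrite -mulrDr -DE mulrCA.
have [Dg D1] := tD (size w); have [_ DE] := Dg.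
rewrite -mulrDr -DE mulrCA ger_pMr // ler_pdivrMl ?exprn_gt0 // mulr1.
apply: le_trans (martingale_le w Dg) _.
by rewrite ger_pMr // exprn_gt0.
Qed.

Lemma potential_rcons Y w b : potential D Y (rcons w b) =
  2 ^- (forced_count Y (size w) + Y (size w)) * mixture D (rcons w b) +
  (surplus Y w + (if b then 1 else - 1) + (Y (size w))%:R) ^+ 2.
Proof.
rewrite /potential size_rcons forced_countS; congr (_ + _ ^+ 2).
rewrite /surplus size_rcons forced_countS -cats1 !count_cat /= !addn0 !natrD.
by case: b => /=; ring.
Qed.

(** At a forced position the mixture at most doubles up to a constant; the new factor 1/2 absorbs
    this, and the surplus is unchanged. At a free position the average over both bits grows by at
    most 1 from the mixture and 1 from the square, and the chosen bit does no worse than the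
    average. *)
Lemma potential_next Y w :
  potential D Y (rcons w (next_bit D Y w)) <= potential D Y w + 2.
Proof.
have M0 := mixture_ge0 (rcons w false); have M1 := mixture_ge0 (rcons w true).
have MM := mixture_rcons w.
have p0 : 0 < (2 : R) ^- forced_count Y (size w) by rewrite invr_gt0 exprn_gt0.
have p1 : (2 : R) ^- forced_count Y (size w) <= 1.
  by rewrite invf_le1 ?exprn_gt0 // exprn_ege1 // ler1n.
have pMM := ler_wpM2l (ltW p0) MM; have pM1 := mulr_ge0 (ltW p0) M1.
rewrite /next_bit; case YE: (Y (size w)) => /=.
  rewrite potential_rcons YE addn1 exprS invfM /potential /=.
  by set p := 2 ^- _ in p0 p1 pMM pM1 *; lra.
have : potential D Y (rcons w false) + potential D Y (rcons w true) <=
    2 * potential D Y w + 4.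
  rewrite !potential_rcons YE addn0 /potential /=.
  by set p := 2 ^- _ in p0 p1 pMM pM1 *; lra.
by case: (leP (potential D Y (rcons w true))) => h1 h2; lra.
Qed.

Lemma potential_diagonal Y n : potential D Y (diagonal_word D Y n) <= 2 * n%:R.
Proof.
elim: n => [|n IHn].
  by rewrite /potential /mixture /surplus /= big_ord0 subrr !mulr0 !add0r expr0n.
by have := potential_next Y (diagonal_word D Y n); rewrite /= -natr1; lra.
Qed.

Lemma surplus_diagonal Y n : surplus Y (diagonal_word D Y n) ^+ 2 <= 2 * n%:R.
Proof.
apply: le_trans (potential_diagonal Y n); rewrite lerDr mulr_ge0 ?mixture_ge0 //.
Qed.

(** A single term of the mixture is at most the whole, and the potential is at most 2n. *)
Lemma test_diagonal Y i n : (i < n)%N ->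
  D i (diagonal_word D Y n) <= 2 ^+ i * 2 ^+ forced_count Y n * (2 * n%:R).
Proof.
move=> ni; set w := diagonal_word D Y n.
have sw : size w = n by exact: size_diagonal_word.
have : 2 ^- i * D i w <= mixture D w.
  rewrite /mixture sw (bigD1 (Ordinal ni)) //= lerDl sumr_ge0 // => j _.
  by have [[D0 _] _] := tD j; rewrite mulr_ge0 // invr_ge0 exprn_ge0.
rewrite ler_pdivrMl ?exprn_gt0 // => /le_trans; apply.
rewrite -mulrA ler_pM2l ?exprn_gt0 // -ler_pdivrMl ?exprn_gt0 //.
have := potential_diagonal Y n; rewrite {1}/potential sw -/w.
by have := sqr_ge0 (surplus Y w); lra.
Qed.

End Bounds.

(** With s < q < 1, the factor q^n dominates n s^n up to a constant and still outweighs 2^(c n),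
    since c n = o(n). *)
Lemma sparse_growth (c : nat -> nat) (s : R) : 0 < s < 1 ->
  (forall K, exists C, forall n, (c n * 2 ^ K <= n + C)%N) ->
  exists B, forall n, s ^+ n * 2 ^+ c n * n%:R <= B.
Proof.
move=> /andP[s0 s1] cK.
pose q := (1 + s) / 2; pose h := q / s - 1.
have q1 : q < 1 by rewrite /q; lra.
have q0 : 0 < q by rewrite /q; lra.
have sq : s < q by rewrite /q; lra.
have h0 : 0 < h by rewrite /h subr_gt0 ltr_pdivlMr // mul1r.
have [N NP] : exists N, forall n, (N <= n)%N -> 2 < q^-1 ^+ n.
  by apply: expr_unbounded; rewrite invf_gt1.
have qN : 2 * q ^+ (2 ^ N) <= 1.
  have : 2 < q^-1 ^+ (2 ^ N) by apply: NP; exact/ltnW/ltn_expl.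
  by rewrite exprVn -ler_pdivlMr ?exprn_gt0 // div1r => /ltW.
have [C CP] := cK N.
(* Raised to the power 2^N, the factor 2^(c n) becomes at most 2^(n + C), and [qN] absorbs n of
   these factors 2. *)
have bound n : q ^+ n * 2 ^+ c n <= 2 ^+ C.
  have N0 : (0 < 2 ^ N)%N by rewrite expn_gt0.
  rewrite -(ler_pXn2r N0) ?nnegrE ?mulr_ge0 ?exprn_ge0 ?(ltW q0) //.
  apply: (@le_trans _ _ (2 ^+ C)); last first.
    by rewrite -exprM ler_weXn2l ?ler1n // leq_pmulr.
  rewrite exprMn -!exprM mulnC exprM.
  apply: (@le_trans _ _ ((q ^+ (2 ^ N)) ^+ n * 2 ^+ (n + C))).
    by rewrite ler_wpM2l ?exprn_ge0 ?(ltW q0) // ler_weXn2l // ler1n.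
  rewrite exprD mulrA -exprMn ger_pMl ?exprn_gt0 // exprn_ile1 ?mulr_ge0 //.
    by rewrite exprn_ge0 // ltW.
  by rewrite mulrC.
exists (2 ^+ C / h) => n; rewrite ler_pdivlMr // -mulrA.
apply: le_trans (bound n).
(* By Bernoulli's inequality; it yields n s^n h <= q^n. *)
have : n%:R * h <= (q / s) ^+ n.
  have := @expr_ge_bernoulli R (q / s) n (divr_ge0 (ltW q0) (ltW s0)).
  rewrite -/h; lra.
move=> /(ler_wpM2l (exprn_ge0 n (ltW s0))).
rewrite -exprMn (mulrC s) divfK ?gt_eqF // => H.
by rewrite -!mulrA [2 ^+ c n * _]mulrC mulrA ler_pM2r ?exprn_gt0.
Qed.

(** Along the diagonal the gale is at most a constant times s^n 2^f n for n > i, where f counts the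
    forced positions; this stays bounded as f = o(n). *)
Lemma sparse_DIM1 D Y : test_family D ->
  (forall d r, 1 <= r < 2 -> ratio_gale r d -> lower_semicomputable d ->
    exists i c s, [/\ 0 <= c, 0 < s < 1 &
      forall w, d w <= c * s ^+ size w * D i w]) ->
  sparse Y -> DIM1 R (diagonal D Y).
Proof.
move=> tD domD sY; apply/DIM1P => d r r12 dg lsc /succeeds_onP dS.
have [i [c [s [c0 s01 dle]]]] := domD d r r12 dg lsc.
have [B BP] := sparse_growth s01 sY.
have [n ni] := dS (c * 2 ^+ i * 2 * B) i.+1; apply/negP; rewrite -leNgt.
rewrite initial_segment_diagonal; apply: le_trans (dle _) _.
rewrite size_diagonal_word.
have s0 : 0 <= c * s ^+ n by rewrite mulr_ge0 // exprn_ge0 //; lra.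
apply: le_trans (ler_wpM2l s0 (test_diagonal tD Y ni)) _.
rewrite [leLHS](_ : _ =
    c * 2 ^+ i * 2 * (s ^+ n * 2 ^+ forced_count Y n * n%:R)).
  by rewrite ler_wpM2l // !mulr_ge0 // exprn_ge0.
ring.
Qed.

Lemma recurrently_dense_not_DIM1 D Y : test_family D ->
  recurrently_dense Y -> ~ DIM1 R (diagonal D Y).
Proof.
move=> tD [K dY]; pose m := (2 ^ K.+1)%N.
apply: (@zero_surplus_not_DIM1 _ _ m) => N.
have [n] := dY (maxn N (2 * m ^ 2).+1); rewrite geq_max => /andP[Nn mn] cn.
exists n => //; rewrite initial_segment_diagonal.
have := surplus_diagonal tD Y n; rewrite /surplus size_diagonal_word.
set o := count_mem true _; set z := count_mem false _.
set S : R := _ + _ => S2.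
have mR : (0 : R) < m%:R by rewrite ltr0n expn_gt0.
have nR : 2 * m%:R ^+ 2 < n%:R :> R by rewrite -natrX -natrM ltr_nat.
(* Zeros exceed ones by f - S, where f is the forced count and mf >= 2n. It suffices that mS <= n,
   which holds because (mS)^2 <= 2 m^2 n < n^2 once n > 2 m^2. *)
have mS : m%:R * S <= n%:R.
  rewrite leNgt; apply/negP => H.
  have h1 : n%:R ^+ 2 < (m%:R * S) ^+ 2.
    by rewrite ltrXn2r // nnegrE ltW // (le_lt_trans _ H).
  have h2 : (m%:R * S) ^+ 2 <= m%:R ^+ 2 * (2 * n%:R).
    by rewrite exprMn ler_wpM2l // sqr_ge0.
  have n0 : (0 : R) < n%:R by apply: lt_trans nR; rewrite mulr_gt0 ?exprn_gt0.
  by nra.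
have cR : 2 * n%:R <= m%:R * (forced_count Y n)%:R :> R.
  by rewrite -!natrM ler_nat /m expnS -mulnA leq_mul2l mulnC.
rewrite -(ler_nat R) natrD !natrM.
move: mS; rewrite /S !mulrDr mulrN; lra.
Qed.

End Potential.

(** * Sets of density zero *)

Section NormalForm.
Variable O : nat -> nat -> set cantor_space.

Definition forces k m (X : cantor_space) n : bool :=
  `[< cylinder X n `<=` O k m >].

(** How many of O k 0, O k 1, ... in succession are secured by the first n bits of X, capped at n.
    For open O k m it is unbounded in n exactly when X lies in all of them. *)
Definition level (X : cantor_space) k n : nat :=
  find (fun m => ~~ forces k m X n) (iota 0 n).

Lemma forces_leq k m X n n' : (n <= n')%N -> forces k m X n -> forces k m X n'.
Proof.
move=> nn' /asboolP XO; apply/asboolP => X' X'X; apply: XO.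
exact: initial_segment_leq X'X.
Qed.

Lemma leq_levelP X k n L : (L <= level X k n)%N <->
  (L <= n)%N /\ forall m, (m < L)%N -> forces k m X n.
Proof.
have szn : (level X k n <= n)%N by rewrite -[leqRHS](size_iota 0) find_size.
split=> [Ln|[Ln LO]].
  split=> [|m mL]; first exact: leq_trans szn.
  have mn : (m < level X k n)%N by exact: leq_trans Ln.
  have := before_find 0%N mn; rewrite nth_iota ?(leq_trans mn) //.
  by move/negbFE.
rewrite leqNgt; apply/negP => nL.
have h : has (fun m => ~~ forces k m X n) (iota 0 n).
  by rewrite has_find size_iota; exact: leq_trans Ln.
have := nth_find 0%N h; rewrite nth_iota; last exact: leq_trans Ln.
by rewrite add0n LO.
Qed.

Lemma level_leq X k n n' : (n <= n')%N -> (level X k n <= level X k n')%N.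
Proof.
move=> nn'; apply/leq_levelP; have /leq_levelP[ln fn] := leqnn (level X k n).
by split=> [|m /fn]; [exact: leq_trans nn'|exact: forces_leq].
Qed.

Lemma cylinder_refl X n : cylinder X n X. Proof. by []. Qed.

Lemma eq_level X X' k n : cylinder X n X' -> level X' k n = level X k n.
Proof.
move=> X'X; apply: eq_find => m; congr (~~ _); rewrite /forces.
by rewrite /cylinder X'X.
Qed.

Definition fires X k j := (level X k j < level X k j.+1)%N.

(** Without firings from J on the level would stay constant, yet finitely many open sets containing
    X, one more than this level, are all secured by a long enough prefix. *)
Lemma fires_infinitely X k : (forall m, open (O k m)) ->
  (forall m, O k m X) -> forall J, exists2 j, (J <= j)%N & fires X k j.
Proof.
move=> oO OX J; apply: contrapT => nf.
have st j : (level X k (J + j) <= level X k J)%N.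
  elim: j => [|j IHj]; first by rewrite addn0.
  rewrite addnS; apply: leq_trans IHj; rewrite leqNgt; apply/negP => h.
  by apply: nf; exists (J + j)%N => //; exact: leq_addr.
pose L := (level X k J).+1.
have [n nL] : exists n, forall m, (m < L)%N -> forces k m X n.
  elim: L => [|L' [n nL]]; first by exists 0%N.
  have /open_cantorP/(_ X (OX L'))[n' n'O] := oO L'.
  exists (maxn n n') => m; rewrite ltnS leq_eqVlt => /predU1P[->|/nL].
    by apply: forces_leq (leq_maxr _ _) _; exact/asboolP.
  by apply: forces_leq; exact: leq_maxl.
have := st (maxn n L); apply/negP; rewrite -ltnNge; apply/leq_levelP.
split; first by apply: leq_trans (leq_maxr n L) _; exact: leq_addl.
move=> m /nL; apply: forces_leq.
by apply: leq_trans (leq_maxl n L) _; exact: leq_addl.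
Qed.

(** The level never exceeds m and each firing raises it; the induction is on the room p left below
    m. *)
Lemma fires_finitely X k m : ~ O k m X ->
  exists J, forall j, (J <= j)%N -> ~~ fires X k j.
Proof.
move=> nO; have bnd n : (level X k n <= m)%N.
  rewrite leqNgt; apply/negP => /leq_levelP[_ /(_ m (ltnSn m))/asboolP].
  by move=> /(_ X (cylinder_refl X n)).
have : forall p J, (m <= level X k J + p)%N ->
    exists J, forall j, (J <= j)%N -> ~~ fires X k j.
  elim=> [|p IHp] J mp.
    exists J => j Jj; rewrite /fires -leqNgt (leq_trans (bnd _)) //.
    by rewrite (leq_trans mp) // addn0 level_leq.
  have [[j Jj fj]|nf] := pselect (exists2 j, (J <= j)%N & fires X k j).
    apply: (IHp j.+1); apply: leq_trans mp _; rewrite addnS -addSn leq_add2r.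
    by apply: leq_ltn_trans fj; exact: level_leq.
  by exists J => j Jj; apply/negP => fj; apply: nf; exists j.
by move=> /(_ m 0%N); apply; rewrite leq_addl.
Qed.

(* The positions [2^j, 2^(j+1)) are governed by stage [j]; a firing of the
   index [k] there selects the multiples of [2^k]. *)
Definition firing_positions X : cantor_space := fun n =>
  `[< exists k, (2 ^ k %| n)%N /\ fires X k (trunc_log 2 n) >].

Lemma firing_positions_continuous : continuous firing_positions.
Proof.
apply: continuous_cantor => X n; exists (trunc_log 2 n).+1 => X' X'X.
have E k : fires X' k (trunc_log 2 n) = fires X k (trunc_log 2 n).
  rewrite /fires (eq_level _ X'X) (@eq_level X) //.
  exact: initial_segment_leq X'X.
apply/asboolP/asboolP => -[k [kn f]]; exists k; split=> //; first by rewrite -E.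
by rewrite E.
Qed.

(** The finitely many indices below K stop firing after some stage J, so that all positions from 2^J
    on are multiples of 2^K. *)
Lemma firing_positions_sparse X : (forall k, exists m, ~ O k m X) ->
  sparse (firing_positions X).
Proof.
move=> nO K; set Y := firing_positions X.
have [J JP] : exists J, forall k j, (k < K)%N -> (J <= j)%N -> ~~ fires X k j.
  elim: K => [|K [J JP]]; first by exists 0%N.
  have [m /fires_finitely[J' J'P]] := nO K; exists (maxn J J') => k j.
  rewrite geq_max ltnS leq_eqVlt => /predU1P[->|kK] /andP[? ?]; first exact: J'P.
  exact: JP.
have YP n : (2 ^ J <= n)%N -> Y n -> (2 ^ K %| n)%N.
  move=> Jn /asboolP[k [kn fk]]; apply: dvdn_trans kn; apply: dvdn_exp2l.
  rewrite leqNgt; apply/negP => kK.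
  have Jn' : (J <= trunc_log 2 n)%N by exact: trunc_log_max.
  by have := JP k _ kK Jn'; rewrite fk.
have cP n : (forced_count Y n.+1 <= 2 ^ J + 1 + n %/ 2 ^ K)%N.
  elim: n => [|n IHn].
    by apply: leq_trans (forced_count_leq Y 1) _; rewrite -addnA addnCA leq_addr.
  have [Jn|nJ] := leqP (2 ^ J) n.+1.
    rewrite forced_countS divnS ?expn_gt0 //.
    have := YP _ Jn; case: (Y n.+1) => [/(_ isT) ->|_].
      by rewrite [leqRHS]addnCA [leqLHS]addnC leq_add2l.
    by rewrite addn0 (leq_trans IHn) // leq_add2l leq_addl.
  apply: leq_trans (forced_count_leq Y n.+2) _.
  by rewrite -addnA (leq_trans nJ) ?leq_addr.
exists ((2 ^ J + 1) * 2 ^ K)%N => n.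
apply: (@leq_trans (forced_count Y n.+1 * 2 ^ K)).
  by rewrite leq_mul2r forced_countS leq_addr orbT.
apply: (@leq_trans ((2 ^ J + 1 + n %/ 2 ^ K) * 2 ^ K)).
  by rewrite leq_mul2r cP orbT.
by rewrite mulnDl addnC leq_add2r leq_trunc_div.
Qed.

(** Whenever k fires at a stage j >= k, all 2^(j - k) multiples of 2^k in the block from 2^j to 2^(j
    + 1) are selected, a proportion 2^-(k + 1) of the positions below 2^(j + 1). *)
Lemma firing_positions_dense X k : (forall m, open (O k m)) ->
  (forall m, O k m X) -> recurrently_dense (firing_positions X).
Proof.
move=> oO OX; exists k.+1 => N; set Y := firing_positions X.
have [j] := fires_infinitely oO OX (maxn N k).
rewrite geq_max => /andP[Nj kj] fj.
have YP t : (t < 2 ^ j)%N -> (2 ^ k %| t)%N -> Y (2 ^ j + t)%N.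
  move=> tj kt; apply/asboolP; exists k; split.
    by rewrite dvdn_add // dvdn_exp2l.
  rewrite (_ : trunc_log 2 _ = j) //; apply: trunc_log_eq => //.
  by rewrite expnS; lia.
have cP t : (t < 2 ^ j)%N -> (t %/ 2 ^ k < forced_count Y (2 ^ j + t.+1))%N.
  elim: t => [|t IHt] tj; rewrite addnS forced_countS.
    by rewrite YP // div0n addn1.
  rewrite divnS ?expn_gt0 //; have := IHt (ltnW tj).
  case: (boolP (2 ^ k %| t.+1)%N) => [/(YP _ tj) -> ct|_].
    by rewrite [ltnRHS]addnC ltn_add2l.
  by rewrite add0n => /leq_trans; apply; exact: leq_addr.
have j0 : (0 < 2 ^ j)%N by rewrite expn_gt0.
exists (2 ^ j.+1)%N.
  by rewrite (leq_trans Nj) // (leq_trans (leqnSn j)) // ltnW // ltn_expl.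
have := cP (2 ^ j).-1; rewrite prednK // leqnn addnn -mul2n -expnS => /(_ isT).
have := ltn_ceil (2 ^ j).-1 (expn_gt0 2 k : (0 < 2 ^ k)%N = true).
rewrite prednK // => h1 h2; rewrite [leqLHS]expnS (expnS 2 k) mulnCA leq_mul2l /=.
by apply: leq_trans h1 _; rewrite leq_mul2r h2 orbT.
Qed.

End NormalForm.

(** * Membership in the third level, hardness, and properness *)

Lemma DIM1_Pi3 (R : realType) : @boldPi cantor_space 3 (DIM1 R).
Proof.
have [e eP] := countable_lower_semicomputable R.
pose good i := exists r, [/\ 1 <= r < 2, ratio_gale r (e i) &
  lower_semicomputable (e i)].
exists (fun i => [set A | good i /\ succeeds_on (e i) A]); split; last first.
  apply/seteqP; split=> A.
    move=> nA; apply: contrapT => nS; apply: nA; apply/DIM1P => d r r12 dg lsc dA.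
    have [i ei] := eP d lsc; apply: nS; exists i => //; split; last by rewrite ei.
    by exists r; rewrite ei.
  by move=> [i _ [[r [r12 dg lsc]] dA]] /DIM1P/(_ _ _ r12 dg lsc).
(* One k serves as bound and as starting length: failure to succeed means staying below k from
   length k on, for some k. A violation is visible in a finite prefix, so each of these sets is
   closed. *)
move=> i; exists (fun k : nat => [set A | good i ->
  forall n, (k <= n)%N -> e i (initial_segment A n) <= k%:R]); split.
  move=> k; apply/open_cantorP => A /not_implyP[gi].
  move=> /existsNP[n /not_implyP[kn /negP eA]].
  by exists n => A' A'A /(_ gi n kn); rewrite A'A; exact/negP.
apply/seteqP; split=> A /=; last first.
  move=> [k _ kP] [gi /succeeds_onP/(_ k%:R k)[n /(kP gi) kn]].
  by rewrite ltNge kn.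
move=> nA; have [gi|ngi] := pselect (good i); last by exists 0%N.
apply: contrapT => nk; apply: nA; split=> //; apply/succeeds_onP => M N.
apply: contrapT => nM; apply: nk; exists (maxn N (Num.bound `|M|)) => // _ n.
rewrite geq_max => /andP[Nn Mn]; apply: (@le_trans _ _ M).
  by rewrite leNgt; apply/negP => Me; apply: nM; exists n.
apply: le_trans (ler_norm _) _.
apply: le_trans (ltW (archi_boundP (normr_ge0 M))) _.
by rewrite ler_nat leq_maxr.
Qed.

Theorem mainTheorem10 (R : realType) :
  [/\ wadge_complete (@boldPi cantor_space 3) (DIM1 R),
      ~ @boldSigma cantor_space 3 (DIM1 R)
    & ~ lightSigma3 (DIM1 R)].
Proof.
have hard A : @boldPi cantor_space 3 A -> wadge_reduces A (DIM1 R).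
  move=> [F [/choice[G GP] AE]].
  (* The complement of A is unfolded as a union over k of intersections over m of open sets O k
     m. *)
  pose O k m := ~` G k m.
  have oO k m : open (O k m) by have [+ _] := GP k; exact.
  have FE k X : F k X <-> forall m, O k m X.
    have [_ E] := GP k; split=> [FX m GX|OX].
      by have : (~` F k) X by rewrite E; exists m.
    by apply: contrapT => nF; have : (~` F k) X by []; rewrite E => -[m _ /OX].
  have nAP X : ~ A X <-> exists k, forall m, O k m X.
    have -> : (~ A X) = (\bigcup_k F k) X by rewrite -AE.
    by split=> [[k _ /FE]|[k /FE]]; exists k.
  have [D [tD domD]] := exists_test_family R.
  exists (diagonal D \o firing_positions O); split.
    move=> X; apply: continuous_comp; first exact: firing_positions_continuous.
    exact: diagonal_continuous.
  (* If X is in A, every k misses some O k m and the forced positions have density 0; otherwise some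
     k fires forever and they have positive upper density. *)
  move=> X; split=> [AX|].
    apply: sparse_DIM1 => //; apply: firing_positions_sparse => k.
    apply: contrapT => nm; have /nAP : exists k, forall m, O k m X; last exact.
    by exists k => m; apply: contrapT => nOX; apply: nm; exists m.
  apply: contraPP => /nAP[k OX]; apply: recurrently_dense_not_DIM1 => //.
  exact: firing_positions_dense (oO k) OX.
have nS : ~ @boldSigma cantor_space 3 (DIM1 R).
  (* A class that is Pi^0_3 but not Sigma^0_3 reduces to the class of sequences of dimension 1, and
     continuous preimages preserve Sigma^0_3. *)
  move=> S; have [A [PA]] := boldPi_not_boldSigma 3; apply.
  have [f [cf fA]] := hard A PA.
  have -> : A = f @^-1` DIM1 R by apply/seteqP; split=> X /fA.
  exact: boldSigma_preimage.
split=> //; first by split; [exact: DIM1_Pi3|exact: hard].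
by move=> /lightSigma3_boldSigma.
Qed.
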